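(* Let $a,b,c,d$ and $t$ be integers such that $v_2(t)=1$ and such that $a$ and $bc+d$ are odd. Suppose that the polynomial $aX^3+bX^2+cX+d+t$ is irreducible over $\mathbb{Q}$ and that its discriminant is a perfect square. Then the equation \[ ax^3+bx^2+cx+d=ty^2\] has no integer solution $(x,y)\in\mathbb{Z}^2$.
   Context: For a nonzero integer $t$, $v_2(t)$ denotes the $2$-adic valuation of $t$, i.e. the exponent of the largest power of $2$ dividing $t$; thus $v_2(t)=1$ means that $t$ is even but not divisible by $4$. *)

(* Defs.v *)
From mathcomp Require Import all_boot all_order all_algebra.

Set Implicit Arguments.
Unset Strict Implicit.
Unset Printing Implicit Defensive.

Import GRing.Theory.
Local Open Scope ring_scope.

(* The discriminant of f of degree n over a field of characteristic zero,
     disc f = (-1)^(n(n-1)/2) Res(f, f') / lc(f).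
   [resultant f f^`()] lists coefficients in ascending order; compared with the
   descending convention this changes the determinant by the sign (-1)^(n(n-1)),
   which is 1. *)
Definition discriminant (f : {poly rat}) : rat :=
  (-1) ^+ 'C((size f).-1, 2) * resultant f f^`() / lead_coef f.

Definition cubic (a b c d : int) : {poly rat} :=
  (a%:~R)%:P * 'X^3 + (b%:~R)%:P * 'X^2 + (c%:~R)%:P * 'X + (d%:~R)%:P.

(* Main.v *)
(** Write f = aX^3+bX^2+cX+d. If f(x) = ty^2, then f(x) is even, and since a
    and bc+d are odd this forces (b, c, d) mod 2 to be (0, 0, 1) or (1, 1, 0):
    modulo 2, f is a linear factor times the irreducible X^2+X+1. In both cases
    the discriminant of f+t is 5 mod 8 (an instance of Stickelberger's theorem),
    so it is not a square. *)

Require Import Defs.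
From mathcomp Require Import all_boot all_order all_algebra zify ring.
Import GRing.Theory.
Local Open Scope ring_scope.

(** With the two lemmas that follow, this turns the parity of a polynomial expression into a boolean
    formula in the parities of its variables, which a finite case split settles. *)
Lemma odd_abszD (m n : int) : odd `|(m + n)%R|%N = odd `|m|%N (+) odd `|n|%N.
Proof. lia. Qed.

Lemma odd_abszM (m n : int) : odd `|(m * n)%R|%N = odd `|m|%N && odd `|n|%N.
Proof. by rewrite abszM oddM. Qed.

Lemma odd_abszX (m : int) (n : nat) : odd `|(m ^+ n)%R|%N = (n == 0)%N || odd `|m|%N.
Proof. by rewrite abszX oddX. Qed.

Lemma odd_absz_half (n : int) : exists m : int, n = 2 * m + (odd `|n|%N)%:Z.
Proof. by exists (n %/ 2)%Z; lia. Qed.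

Lemma even_absz_half (n : int) : ~~ odd `|n|%N -> exists m : int, n = 2 * m.
Proof. by exists (n %/ 2)%Z; lia. Qed.

Lemma sqr_odd_mod8 (n : int) : odd `|n|%N -> exists k : int, n ^+ 2 = 8 * k + 1.
Proof.
move=> on; have [m] := odd_absz_half n; rewrite on /= => ->.
have [l e] : exists l : int, m * (m + 1) = 2 * l.
  by apply: even_absz_half; rewrite odd_abszM odd_abszD; case: (odd `|m|).
exists l; rewrite (_ : _ ^+ 2 = 4 * (m * (m + 1)) + 1); last by ring.
by rewrite e; ring.
Qed.

Lemma sqr_mod8_neq5 (s k : int) : s ^+ 2 <> 8 * k + 5.
Proof.
case os: (odd `|s|).
  by have [l ->] := sqr_odd_mod8 s os; lia.
have [m ->] := even_absz_half s (negbT os).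
rewrite (_ : (2 * m) ^+ 2 = 4 * m ^+ 2); last by ring.
by lia.
Qed.

Definition cubic_disc {R : pzRingType} (a b c d : R) : R :=
  b ^+ 2 * c ^+ 2 - 4 * a * c ^+ 3 - 4 * b ^+ 3 * d - 27 * a ^+ 2 * d ^+ 2
  + 18 * a * b * c * d.

Lemma cubic_disc_mod8 (a b c d x : int) :
    odd `|a|%N -> odd `|(b * c + d)%R|%N ->
    ~~ odd `|(a * x ^+ 3 + b * x ^+ 2 + c * x + d)%R|%N ->
  exists k : int, cubic_disc a b c d = 8 * k + 5.
Proof.
move=> oa obcd efx.
(* An odd [x] forces the first pattern and an even [x] the second. *)
have : [&& ~~ odd `|b|, ~~ odd `|c| & odd `|d|] || [&& odd `|b|, odd `|c| & ~~ odd `|d|].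
  move: obcd efx; rewrite !(odd_abszD, odd_abszM, odd_abszX) oa /=.
  by case: (odd `|b|) (odd `|c|) (odd `|d|) (odd `|x|) => -[] [] [].
rewrite /cubic_disc; case/orP=> /and3P[].
  (* With [b] and [c] even, every term except [-27 (ad)^2] is divisible by 8, and
     [-27 = 8 * (-4) + 5]. *)
  move=> /even_absz_half[b' ->] /even_absz_half[c' ->] od.
  have [w ew] : exists w, (a * d) ^+ 2 = 8 * w + 1.
    by apply: sqr_odd_mod8; rewrite odd_abszM oa od.
  exists (2 * b' ^+ 2 * c' ^+ 2 - 4 * a * c' ^+ 3 - 4 * b' ^+ 3 * d - 27 * w
          + 9 * a * b' * c' * d - 4).
  rewrite [LHS](_ : _ = 16 * b' ^+ 2 * c' ^+ 2 - 32 * a * c' ^+ 3 - 32 * b' ^+ 3 * d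
                     - 27 * (a * d) ^+ 2 + 72 * a * b' * c' * d); last by ring.
  by rewrite ew; ring.
(* With [d = 2e], modulo 8 the term [(bc)^2] is 1 and [4ac^3] is 4, which leaves [-3], i.e. 5. The
   remaining terms vanish: [e(bc - 3ae)] is even because [bc] and [3a] are odd. *)
move=> ob oc /even_absz_half[e ->].
have [w ew] : exists w, (b * c) ^+ 2 = 8 * w + 1.
  by apply: sqr_odd_mod8; rewrite odd_abszM ob oc.
have [k ek] : exists k, a * c ^+ 3 - 1 = 2 * k.
  by apply: even_absz_half; rewrite odd_abszD odd_abszM odd_abszX oa oc.
have [m em] : exists m, e * (b * c - 3 * a * e) = 2 * m.
  apply: even_absz_half; rewrite !(odd_abszD, abszN, odd_abszM) oa ob oc /=.
  by case: (odd `|e|).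
exists (w - k - b ^+ 3 * e + 9 * a * m - 1).
rewrite [LHS](_ : _ = (b * c) ^+ 2 - 4 * (a * c ^+ 3 - 1) - 4 - 8 * b ^+ 3 * e
                   + 36 * a * (e * (b * c - 3 * a * e))); last by ring.
by rewrite ew ek em; ring.
Qed.

(* Indexing by nat rather than by ordinals lets the expansion of a concrete
   determinant be carried out by reduction. *)
Fixpoint laplace_det {R : pzRingType} (n : nat) (F : nat -> nat -> R) : R :=
  if n is n'.+1 then
    \sum_(j < n'.+1) F 0 j * ((-1) ^+ j * laplace_det n' (fun k l => F k.+1 (bump j l)))
  else 1.

Arguments laplace_det : simpl never.

Lemma laplace_detS {R : pzRingType} (n : nat) (F : nat -> nat -> R) :
  laplace_det n.+1 F =
  \sum_(j < n.+1) F 0 j * ((-1) ^+ j * laplace_det n (fun k l => F k.+1 (bump j l))).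
Proof. by []. Qed.

Lemma det_laplace {R : comPzRingType} (n : nat) (F : nat -> nat -> R) :
  \det (\matrix_(i < n, j < n) F i j) = laplace_det n F.
Proof.
elim: n F => [|n IHn] F; first exact: det_mx00.
rewrite (expand_det_row _ 0) laplace_detS; apply: eq_bigr => j _; rewrite mxE /cofactor -IHn.
by congr (_ * (_ * \det _)); apply/matrixP=> k l; rewrite !mxE.
Qed.

(** Taking plain sequences lets the entries compute on explicit coefficient lists. The boolean
    multiplicities kill the entries where truncated subtraction would wrongly return the constant
    coefficient. *)
Definition sylvester_coef {R : nmodType} (p q : seq R) (i j : nat) : R :=
  if (i < (size q).-1)%N then p`_(j - i) *+ (i <= j)%N
  else q`_(j - (i - (size q).-1)) *+ (i - (size q).-1 <= j)%N.

Lemma resultant_laplace {R : comNzRingType} (p q : {poly R}) :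
  resultant p q = laplace_det ((size q).-1 + (size p).-1) (sylvester_coef p q).
Proof.
rewrite /resultant -det_laplace; congr (\det _); apply/matrixP=> i j.
rewrite Sylvester_mxE mxE /sylvester_coef; case: splitP => k -> //=.
by rewrite addKn.
Qed.

Lemma polyseq_cubic (a b c d : int) : a != 0 ->
  cubic a b c d = [:: d%:~R; c%:~R; b%:~R; a%:~R] :> seq rat.
Proof.
move=> a0; set r := [:: _; _; _; _].
suff -> : cubic a b c d = Poly r by rewrite (@PolyK _ 0) //= intr_eq0.
apply/polyP=> i; rewrite coef_Poly /cubic.
rewrite !coefD !coefCM coefC !coefXn coefX.
by case: i => [|[|[|[|i]]]] /=; rewrite ?nth_nil; ring.
Qed.

Lemma polyseq_deriv_cubic (a b c d : int) : a != 0 ->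
  (cubic a b c d)^`() = [:: c%:~R; b%:~R *+ 2; a%:~R *+ 3] :> seq rat.
Proof.
move=> a0; set r := [:: _; _; _].
suff -> : (cubic a b c d)^`() = Poly r.
  by rewrite (@PolyK _ 0) //= Num.Theory.mulrn_eq0 intr_eq0.
apply/polyP=> i; rewrite coef_Poly coef_deriv polyseq_cubic //.
by case: i => [|[|[|i]]] //=; rewrite ?nth_nil ?mul0rn.
Qed.

Lemma det_sylvester_cubic {R : comNzRingType} (a b c d : R) :
  laplace_det 5 (sylvester_coef [:: d; c; b; a] [:: c; b *+ 2; a *+ 3])
  = - (a * cubic_disc a b c d).
Proof.
(* Each round expands one row and discards the minors with a zero factor before the next round
   expands them further. *)
do 5!rewrite !laplace_detS !big_ord_recl !big_ord0 /sylvester_coef /bump /=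
  ?(mulr0n, mulr1n, mul0r, mulr0, add0r, addr0).
by rewrite /laplace_det /cubic_disc; ring.
Qed.

Lemma discriminant_cubic (a b c d : int) : a != 0 ->
  discriminant (cubic a b c d) = (cubic_disc a b c d)%:~R.
Proof.
move=> a0; have a0' : a%:~R != 0 :> rat by rewrite intr_eq0.
rewrite /discriminant resultant_laplace lead_coefE.
rewrite polyseq_deriv_cubic // polyseq_cubic // det_sylvester_cubic.
(* The binomial 'C(3, 2) = 3 is odd, so its sign cancels the minus sign of the resultant; the factor
   [a] cancels the leading coefficient. *)
rewrite -signr_odd mulN1r opprK [_ / _]mulrAC mulfV // mul1r.
by rewrite /cubic_disc; ring.
Qed.

Theorem corollary3 (a b c d t : int)
    (v2t : t != 0 /\ logn 2 `|t|%N = 1%N)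
    (odd_a : odd `|a|%N)
    (odd_bcd : odd `|(b * c + d)%R|%N)
    (irr_f : irreducible_poly (cubic a b c (d + t)))
    (sq_disc : exists s : int, discriminant (cubic a b c (d + t)) = (s ^+ 2)%:~R) :
  ~ (exists x y : int,
       a * x ^+ 3 + b * x ^+ 2 + c * x + d = t * y ^+ 2).
Proof.
case=> x [y eq_xy]; case: sq_disc => s; case: v2t => t0 v2t.
have even_t : ~~ odd `|t|%N.
  by rewrite -dvdn2 -[2%N]expn1 pfactor_dvdn ?absz_gt0 ?v2t.
have a0 : a != 0 by apply: contraTneq odd_a => ->.
rewrite discriminant_cubic // => /intr_inj eq_s.
(* As [t] is even, adding it to [d] preserves the parity of [bc + d], and the value of the shifted
   cubic at [x] is [ty^2 + t], again even. *)
have [||k] := @cubic_disc_mod8 a b c (d + t) x odd_a.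
- by rewrite addrA odd_abszD odd_bcd.
- by rewrite addrA eq_xy odd_abszD odd_abszM (negPf even_t).
by rewrite eq_s; apply: sqr_mod8_neq5.
Qed.
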